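(* Let $\Bbbk$ be a field, $q\in\Bbbk^*$ any nonzero element, and $m\le n$ positive integers. Let $\Pi=\Pi_{m,n}$ be the set of maximal quantum minors of $\mathcal{O}_q(M_{m,n}(\Bbbk))$ with its standard partial order $\le_{\mathrm{st}}$. Let $P$ be a prime ideal of $\mathcal{O}_q(G_{m,n}(\Bbbk))$ with $P\ne\langle\Pi\rangle$ (that is, $P$ is not the irrelevant ideal). Then there is a unique $\gamma\in\Pi$ with the property that $\gamma\notin P$ but $\pi\in P$ for all $\pi\in\Pi$ with $\pi\not\ge_{\mathrm{st}}\gamma$.
   Context: The algebra of quantum matrices $\mathcal{O}_q(M_{m,n}(\Bbbk))$ is the $\Bbbk$-algebra generated by $x_{ij}$ ($1\le i\le m$, $1\le j\le n$) subject to the relations: $x_{ij}x_{il}=qx_{il}x_{ij}$ for $j<l$; $x_{ij}x_{kj}=qx_{kj}x_{ij}$ for $i<k$; $x_{ij}x_{kl}=x_{kl}x_{ij}$ for $k<i$ and $j<l$; $x_{ij}x_{kl}-x_{kl}x_{ij}=(q-q^{-1})x_{il}x_{kj}$ for $i<k$ and $j<l$. For $I=\{i_1<\dots<i_m\}\subseteq\{1,\dots,n\}$ the maximal quantum minor is $[I]=[i_1,\dots,i_m]=\sum_{\sigma\in\mathfrak{S}_m}(-q)^{\ell(\sigma)}x_{\sigma(1)i_1}\cdots x_{\sigma(m)i_m}$, where $\ell$ is the length function. The quantum grassmannian $\mathcal{O}_q(G_{m,n}(\Bbbk))$ is the subalgebra of $\mathcal{O}_q(M_{m,n}(\Bbbk))$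 generated by all maximal quantum minors. $\Pi_{m,n}$ denotes the set of $m$-element subsets of $\{1,\dots,n\}$, identified with the set of maximal quantum minors via $I\mapsto[I]$; for $I=\{i_1<\dots<i_m\}$ and $J=\{j_1<\dots<j_m\}$, $I\le_{\mathrm{st}}J$ means $i_s\le j_s$ for all $1\le s\le m$. $\langle\Pi\rangle$ is the two-sided ideal generated by $\Pi$. Prime ideals are taken in the noncommutative sense. *)

(* Defs.v *)
From HB Require Import structures.
From mathcomp Require Import all_boot all_order all_algebra all_fingroup.
From mathcomp Require Import generic_quotient.
From mathcomp Require Import boolp classical_sets.
From mathcomp.multinomials Require Import monalg.

Set Implicit Arguments.
Unset Strict Implicit.
Unset Printing Implicit Defensive.

Import GRing.Theory.

Local Open Scope ring_scope.
Local Open Scope quotient_scope.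
Local Open Scope classical_set_scope.

Section Ideals.
Variable A : pzRingType.

(* Two-sided; closure under opposites follows from -x = (-1) * x. *)
Record ideal (I : set A) : Prop := Ideal {
  ideal0 : I 0;
  idealD : forall x y, I x -> I y -> I (x + y);
  idealMl : forall a x, I x -> I (a * x);
  idealMr : forall a x, I x -> I (x * a) }.

Definition ideal_gen (S : set A) : set A :=
  fun a => forall I, ideal I -> S `<=` I -> I a.

Lemma ideal_gen_ideal S : ideal (ideal_gen S).
Proof.
split=> [I /ideal0 //|x y Sx Sy I iI SI|a x Sx I iI SI|a x Sx I iI SI].
- by apply: idealD => //; [exact: Sx|exact: Sy].
- by apply: idealMl => //; exact: Sx.
- by apply: idealMr => //; exact: Sx.
Qed.

Lemma idealN I x : ideal I -> I x -> I (- x).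
Proof. by move=> iI Ix; rewrite -mulN1r; apply: idealMl. Qed.

(* The condition [set x * y | x in I & y in J] `<=` P is I J `<=` P, as the
   product ideal I J consists of the finite sums of such x * y. *)
Definition prime_ideal (P : set A) : Prop :=
  [/\ ideal P, P <> setT &
      forall I J, ideal I -> ideal J ->
        [set x * y | x in I & y in J] `<=` P -> I `<=` P \/ J `<=` P].

End Ideals.

Section Subalgebra.
Variables (k : fieldType) (A : algType k).

Definition subalg_gen (S : set A) : {pred A} :=
  fun a => `[< forall B : {pred A}, GRing.subalg_closed B ->
                 (forall s, S s -> s \in B) -> a \in B >].

Lemma subalg_genP (S : set A) a :
  reflect (forall B : {pred A}, GRing.subalg_closed B ->
             (forall s, S s -> s \in B) -> a \in B) (a \in subalg_gen S).
Proof. exact: asboolP. Qed.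

Lemma mem_subalg_gen (S : set A) s : S s -> s \in subalg_gen S.
Proof. by move=> Ss; apply/subalg_genP => B _; apply. Qed.

Lemma subalg_gen_closed (S : set A) : GRing.subsemialg_closed (subalg_gen S).
Proof.
apply: GRing.subalg_closed_semi; split.
- by apply/subalg_genP => B [].
- move=> c u v /subalg_genP Su /subalg_genP Sv; apply/subalg_genP => B clB SB.
  by have [_ linB _] := clB; apply: linB; [exact: Su|exact: Sv].
- move=> u v /subalg_genP Su /subalg_genP Sv; apply/subalg_genP => B clB SB.
  by have [_ _ mulB] := clB; apply: mulB; [exact: Su|exact: Sv].
Qed.

HB.instance Definition _ S :=
  GRing.isSubalgClosed.Build k A (subalg_gen S) (subalg_gen_closed S).

Variable S : set A.

Definition subalg := {a : A | a \in subalg_gen S}.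

HB.instance Definition _ := SubChoice.on subalg.
HB.instance Definition _ := [SubChoice_isSubAlgebra of subalg by <:].

End Subalgebra.

Section QuotientAlgebra.
Variables (k : fieldType) (A : algType k).

Record properIdeal := ProperIdeal {
  properIdeal_set :> A -> Prop;
  properIdealP : ideal properIdeal_set;
  properIdeal1 : ~ properIdeal_set 1 }.

Variable I : properIdeal.
Let idI : ideal I := properIdealP I.

Definition quot_equiv (a b : A) : bool := `[< I (a - b) >].

Lemma quot_equiv_is_equiv : equiv_class_of quot_equiv.
Proof.
split=> [a|a b|b a c].
- by apply/asboolP; rewrite subrr; apply: (ideal0 idI).
- by apply/asboolP/asboolP => h; rewrite -opprB; apply: (idealN idI).
- move=> /asboolP ab /asboolP bc; apply/asboolP.
  by rewrite -(subrKA b); apply: (idealD idI).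
Qed.

Canonical quot_equiv_equiv := EquivRelPack quot_equiv_is_equiv.
Canonical quot_equiv_enc := defaultEncModRel quot_equiv.

Definition quot := {eq_quot quot_equiv}.
HB.instance Definition _ := Choice.on quot.
HB.instance Definition _ := EqQuotient.on quot.

Lemma quot_eqP a b : reflect (I (a - b)) (a == b %[mod quot]).
Proof. by rewrite eqmodE; apply: asboolP. Qed.

Lemma quot_reprP a : I (a - repr (\pi_quot a)).
Proof. by apply/quot_eqP; rewrite reprK. Qed.

Definition quot_zero : quot := lift_cst quot 0.
Definition quot_one : quot := lift_cst quot 1.
Definition quot_add := lift_op2 quot +%R.
Definition quot_opp := lift_op1 quot -%R.
Definition quot_mul := lift_op2 quot *%R.
Definition quot_scale (c : k) := lift_op1 quot ( *:%R c).

Canonical quot_pi_zero := PiConst quot_zero.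
Canonical quot_pi_one := PiConst quot_one.

Lemma quot_pi_oppE : {morph \pi_quot : x / - x >-> quot_opp x}.
Proof.
move=> x; unlock quot_opp; apply/eqP/quot_eqP.
by rewrite -opprD; apply: (idealN idI); apply: quot_reprP.
Qed.
Canonical quot_pi_opp := PiMorph1 quot_pi_oppE.

Lemma quot_pi_addE : {morph \pi_quot : x y / x + y >-> quot_add x y}.
Proof.
move=> x y; unlock quot_add; apply/eqP/quot_eqP.
by rewrite opprD addrACA; apply: (idealD idI); apply: quot_reprP.
Qed.
Canonical quot_pi_add := PiMorph2 quot_pi_addE.

Lemma quot_pi_mulE : {morph \pi_quot : x y / x * y >-> quot_mul x y}.
Proof.
move=> x y; unlock quot_mul; apply/eqP/quot_eqP.
rewrite -(subrKA (repr (\pi_quot x) * y)) -mulrBl -mulrBr.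
by apply: (idealD idI); [apply: (idealMr idI)|apply: (idealMl idI)];
  apply: quot_reprP.
Qed.
Canonical quot_pi_mul := PiMorph2 quot_pi_mulE.

Lemma quot_pi_scaleE c : {morph \pi_quot : x / c *: x >-> quot_scale c x}.
Proof.
move=> x; unlock quot_scale; apply/eqP/quot_eqP.
by rewrite -scalerBr -mulr_algl; apply: (idealMl idI); apply: quot_reprP.
Qed.
Canonical quot_pi_scale c := PiMorph1 (quot_pi_scaleE c).

Fact quot_addA : associative quot_add.
Proof. by move=> x y z; rewrite -[x]reprK -[y]reprK -[z]reprK !piE addrA. Qed.

Fact quot_addC : commutative quot_add.
Proof. by move=> x y; rewrite -[x]reprK -[y]reprK !piE addrC. Qed.

Fact quot_add0 : left_id quot_zero quot_add.
Proof. by move=> x; rewrite -[x]reprK !piE add0r. Qed.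

Fact quot_addN : left_inverse quot_zero quot_opp quot_add.
Proof. by move=> x; rewrite -[x]reprK !piE addNr. Qed.

HB.instance Definition _ :=
  GRing.isZmodule.Build quot quot_addA quot_addC quot_add0 quot_addN.

Fact quot_mulA : associative quot_mul.
Proof. by move=> x y z; rewrite -[x]reprK -[y]reprK -[z]reprK !piE mulrA. Qed.

Fact quot_mul1 : left_id quot_one quot_mul.
Proof. by move=> x; rewrite -[x]reprK !piE mul1r. Qed.

Fact quot_mulr1 : right_id quot_one quot_mul.
Proof. by move=> x; rewrite -[x]reprK !piE mulr1. Qed.

Fact quot_mulDl : left_distributive quot_mul quot_add.
Proof. by move=> x y z; rewrite -[x]reprK -[y]reprK -[z]reprK !piE mulrDl. Qed.

Fact quot_mulDr : right_distributive quot_mul quot_add.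
Proof. by move=> x y z; rewrite -[x]reprK -[y]reprK -[z]reprK !piE mulrDr. Qed.

Fact quot_one_neq0 : quot_one != quot_zero.
Proof.
rewrite !piE; apply/negP => /asboolP; rewrite subr0.
exact: properIdeal1.
Qed.

HB.instance Definition _ := GRing.Zmodule_isNzRing.Build quot
  quot_mulA quot_mul1 quot_mulr1 quot_mulDl quot_mulDr quot_one_neq0.

Fact quot_scaleA a b v : quot_scale a (quot_scale b v) = quot_scale (a * b) v.
Proof. by rewrite -[v]reprK !piE scalerA. Qed.

Fact quot_scale1 : left_id 1 quot_scale.
Proof. by move=> v; rewrite -[v]reprK !piE scale1r. Qed.

Fact quot_scaleDr : right_distributive quot_scale +%R.
Proof.
move=> a u v; rewrite -[u]reprK -[v]reprK.
rewrite -[LHS]/(quot_scale a (quot_add _ _)) -[RHS]/(quot_add _ _).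
by rewrite !piE scalerDr.
Qed.

Fact quot_scaleDl v : {morph quot_scale^~ v : a b / a + b}.
Proof.
by move=> a b /=; rewrite -[v]reprK -[RHS]/(quot_add _ _) !piE scalerDl.
Qed.

HB.instance Definition _ := GRing.Zmodule_isLmodule.Build k quot
  quot_scaleA quot_scale1 quot_scaleDr quot_scaleDl.

Fact quot_scaleAl (a : k) (u v : quot) : a *: (u * v) = (a *: u) * v.
Proof.
rewrite -[u]reprK -[v]reprK -[LHS]/(quot_scale a (quot_mul _ _)).
by rewrite -[RHS]/(quot_mul (quot_scale _ _) _) !piE scalerAl.
Qed.

HB.instance Definition _ := GRing.Lmodule_isLalgebra.Build k quot quot_scaleAl.

Fact quot_scaleAr (a : k) (u v : quot) : a *: (u * v) = u * (a *: v).
Proof.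
rewrite -[u]reprK -[v]reprK -[LHS]/(quot_scale a (quot_mul _ _)).
by rewrite -[RHS]/(quot_mul _ (quot_scale _ _)) !piE scalerAr.
Qed.

HB.instance Definition _ := GRing.Lalgebra_isAlgebra.Build k quot quot_scaleAr.

(* The library already attaches morphism instances to \pi for its own quotient
   structures, so the algebra morphism instance is put on this alias. *)
Definition quot_pi (a : A) : quot := \pi_quot a.

Fact quot_pi_linear : linear quot_pi.
Proof.
move=> a u v; rewrite /quot_pi -[RHS]/(quot_add (quot_scale _ _) _).
by rewrite !piE.
Qed.

Fact quot_pi_monoid : monoid_morphism quot_pi.
Proof.
rewrite /quot_pi; split=> [|u v]; first by rewrite -[RHS]/quot_one !piE.
by rewrite -[RHS]/(quot_mul _ _) !piE.
Qed.

HB.instance Definition _ :=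
  GRing.isLinear.Build k A quot _ quot_pi quot_pi_linear.
HB.instance Definition _ :=
  GRing.isMonoidMorphism.Build A quot quot_pi quot_pi_monoid.

Lemma quot_pi_eq0 a : quot_pi a = 0 <-> I a.
Proof.
rewrite -[a in I a]subr0; split=> [/eqP|Ia].
  by rewrite -(raddf0 quot_pi) => /quot_eqP.
by apply/eqP; rewrite -(raddf0 quot_pi); apply/quot_eqP.
Qed.

End QuotientAlgebra.

Fact malg_scaleAr (k : fieldType) (K : monomType) (a : k)
  (u v : {malg k[K]}) : a *: (u * v) = u * (a *: v).
Proof.
rewrite -[a *: (u * v)]mul_malgC -[a *: v]mul_malgC.
rewrite [LHS]mulrA [RHS]mulrA; congr (_ * v).
rewrite [LHS]malgM_def [RHS]malgM_def fgmulUg fgmulgU; apply: eq_bigr => w _.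
by rewrite mul1m mulm1 mulrC.
Qed.

Section FreeAlgebra.
Variables (k : fieldType) (T : choiceType).

(* The free associative algebra on T, as the algebra of the free monoid of words
   in T. *)
Definition free_alg := {malg k[{fmonom T}]}.

HB.instance Definition _ := GRing.Lalgebra.on free_alg.

Fact free_alg_scaleAr (a : k) (u v : free_alg) : a *: (u * v) = u * (a *: v).
Proof. exact: malg_scaleAr. Qed.

HB.instance Definition _ :=
  GRing.Lalgebra_isAlgebra.Build k free_alg free_alg_scaleAr.

End FreeAlgebra.

HB.lock Definition free_gen (k : fieldType) (T : choiceType) (t : T) :
  free_alg k T := << fmu t >>.

(* Sending every generator to 0 shows that the quotient below is nonzero. *)
Section Augmentation.
Variables (k : fieldType) (T : choiceType).

Definition free_aug (a : free_alg k T) : k := mcoeff mone a.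

Fact free_aug_zmod : zmod_morphism free_aug.
Proof. exact: raddfB. Qed.

Fact free_aug_monoid : monoid_morphism free_aug.
Proof. by split; [exact: rmorph1|exact: rmorphM]. Qed.

HB.instance Definition _ :=
  GRing.isZmodMorphism.Build (free_alg k T) k free_aug free_aug_zmod.
HB.instance Definition _ :=
  GRing.isMonoidMorphism.Build (free_alg k T) k free_aug free_aug_monoid.

Lemma free_aug_gen t : free_aug (free_gen k t) = 0.
Proof. by rewrite unlock /free_aug mcoeffU1 fm1_eq1. Qed.

Lemma free_aug1 : free_aug 1 = 1.
Proof. exact: rmorph1. Qed.

Lemma free_augB u v : free_aug (u - v) = free_aug u - free_aug v.
Proof. exact: raddfB. Qed.

Lemma free_augZ a u : free_aug (a *: u) = a * free_aug u.
Proof. exact: mcoeffZ. Qed.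

Lemma free_aug_genM t t' : free_aug (free_gen k t * free_gen k t') = 0.
Proof. by rewrite rmorphM /= unlock {1}/free_aug mcoeffU1 fm1_eq1 mul0r. Qed.

End Augmentation.

Section QuantumMatrices.
Variables (k : fieldType) (q : k) (m n : nat).

Definition qmx_idx : choiceType := Choice.clone ('I_m * 'I_n)%type _.

Definition qmx_free : algType k := GRing.Algebra.clone k (free_alg k qmx_idx) _.

Local Notation X i j := (@free_gen k qmx_idx (i, j) : qmx_free).

Inductive qmx_rel : set qmx_free :=
| QmxRow (i : 'I_m) (j l : 'I_n) of (j < l)%N :
    qmx_rel (X i j * X i l - q *: (X i l * X i j))
| QmxCol (i t : 'I_m) (j : 'I_n) of (i < t)%N :
    qmx_rel (X i j * X t j - q *: (X t j * X i j))
| QmxComm (i t : 'I_m) (j l : 'I_n) of (t < i)%N & (j < l)%N :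
    qmx_rel (X i j * X t l - X t l * X i j)
| QmxCross (i t : 'I_m) (j l : 'I_n) of (i < t)%N & (j < l)%N :
    qmx_rel (X i j * X t l - X t l * X i j - (q - q^-1) *: (X i l * X t j)).

Fact qmx_rel_proper : ~ ideal_gen qmx_rel 1.
Proof.
move=> /(_ (fun a => free_aug a = 0)) h.
suff /eqP : (1 : k) = 0 by rewrite oner_eq0.
rewrite -(free_aug1 k qmx_idx); apply: h => [|_ [] *].
- split=> [|x y x0 y0|a x x0|a x x0].
  + exact: raddf0.
  + by rewrite raddfD /= x0 y0 addr0.
  + by rewrite rmorphM /= x0 mulr0.
  + by rewrite rmorphM /= x0 mul0r.
- rewrite [LHS]free_augB [W in _ - W]free_augZ.
  by rewrite [W in W - _]free_aug_genM [W in _ * W]free_aug_genM mulr0 subrr.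
- rewrite [LHS]free_augB [W in _ - W]free_augZ.
  by rewrite [W in W - _]free_aug_genM [W in _ * W]free_aug_genM mulr0 subrr.
- rewrite [LHS]free_augB.
  by rewrite [W in W - _]free_aug_genM [W in _ - W]free_aug_genM subrr.
- rewrite [LHS]free_augB [W in W - _]free_augB [W in _ - W]free_augZ.
  rewrite [W in W - _ - _]free_aug_genM [W in _ - W - _]free_aug_genM.
  by rewrite [W in _ * W]free_aug_genM mulr0 !subrr.
Qed.

Definition qmx_ideal : properIdeal qmx_free :=
  ProperIdeal (ideal_gen_ideal qmx_rel) qmx_rel_proper.

(* O_q(M_{m,n}(k)), with rows and columns numbered from 0. *)
Definition qmx : algType k := GRing.Algebra.clone k (quot qmx_ideal) _.

Definition qmx_x (i : 'I_m) (j : 'I_n) : qmx := quot_pi qmx_ideal (X i j).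

Definition Pi := {I : {set 'I_n} | #|I| == m}.

(* enum lists the elements of a set of ordinals in increasing order, so for
   I = {i_1 < ... < i_m} this is the increasing enumeration of I. *)
Definition Pi_elt (I : Pi) (s : 'I_m) : 'I_n :=
  enum_val (cast_ord (esym (eqP (valP I))) s).

Definition le_st (I J : Pi) : bool := [forall s, Pi_elt I s <= Pi_elt J s]%N.

(* The length of a permutation is its number of inversions. *)
Definition perm_length (s : 'S_m) : nat :=
  #|[pred ab : 'I_m * 'I_m | (ab.1 < ab.2)%N && (s ab.2 < s ab.1)%N]|.

Definition qminor (I : Pi) : qmx :=
  \sum_(s : 'S_m) (- q) ^+ perm_length s *:
    \prod_(a < m) qmx_x (s a) (Pi_elt I a).

(* O_q(G_{m,n}(k)). *)
Definition qgrass := subalg (range qminor).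

Definition qgrass_minor (I : Pi) : qgrass :=
  exist _ (qminor I) (mem_subalg_gen (imageT qminor I)).

Definition irrelevant_ideal : set qgrass := ideal_gen (range qgrass_minor).

End QuantumMatrices.

Arguments irrelevant_ideal {k} q m n.

(* Main.v *)
Require Import Defs.
From HB Require Import structures.
From mathcomp Require Import boolp classical_sets.
From mathcomp Require Import all_boot all_order all_algebra all_fingroup.
From mathcomp Require Import ring.

(** A quantum minor [I] outside P, chosen minimal in a suitable sense, is
    normal modulo P, which forces every [J] that is not above [I] for the standard
    order into P.  Two identities among maximal minors carry the argument.

    Exchange: for a in J but not in I,
        [I][J] = sum over b in I outside J of c_b [I - b + a][J - a + b],
    with scalars c_b (qgrass_exchange).

    Commutation: there is a nonzero scalar c such that [J][I] - c [I][J] is a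
    linear combination of products [I'][J'] in which I' has smaller weight than
    I, the weight of a set of columns being the sum of its elements (qgrass_comm).

    Let gamma have least weight among the minors outside P; it exists because a
    proper ideal containing all the minors is the irrelevant ideal
    (prime_irrelevant).  All minors of smaller weight lie in P, so by commutation
    gamma is normal modulo P.  As P is prime, gamma a in P then
    implies a in P (prime_normal).  Now let alpha be not above gamma, and argue
    by induction on its weight.  Pick a in alpha outside gamma and exchange.  In
    the terms with b > a the first factor has weight less than gamma, hence lies
    in P.  In the terms with b < a the second factor is standardly below alpha,
    hence not above gamma, and lies in P by induction.  So gamma alpha is in P,
    and alpha is in P.  Two elements gamma with the required property are below
    one another, whence uniqueness.

    The two identities come from the quantum exterior algebra with generators
    e_1, ..., e_n subject to e_s e_s = 0 and e_t e_s = - q e_s e_t for s < t, with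
    coefficients in the algebra of quantum matrices.  It is realised on functions
    on sets of columns, right multiplication by e_s being a creation operator.
    The rows y_i = sum_s x_is e_s square to 0 and commute with one another up to
    nonzero scalars, and the coefficients of y_1 ... y_m are the maximal minors,
    so y_1 ... y_m y_i = 0 is a Cramer rule for each row i (minor_cramer).

    For the commutation of x_ij with the minors, the relations between the entries
    of two rows are rewritten as one identity of R-matrix type (qm_exchange).  It
    moves x_ij to the right of y_1 ... y_m at the cost of operators hop r j, which
    replace e_j by a multiple of e_r for r > j, and of terms in which y_t is
    exchanged for y_i (transfer_rowmul).  If y_i is first moved to the end of the
    product, each exchanged term contains y_i twice and vanishes.  The scalars in
    the resulting formula (minor_comm_entry) do not depend on the row i.

    The maximal minors are also the top coefficients of products of columns
    z_j = sum_i x_ij f_i in the exterior algebra on the rows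
    (rowprod_colprod).  Statements that hold for all the entries of a column
    simultaneously can therefore be multiplied by further columns, and turn into
    statements on products of two minors (minor_exchange, minor_comm). *)

Set Implicit Arguments.
Unset Strict Implicit.
Unset Printing Implicit Defensive.
Import GRing.Theory.
Local Open Scope ring_scope.

(** * The quantum exterior algebra as a Fock space *)

Section FockSpace.
Variables (k : fieldType) (q : k) (A : algType k) (p : nat).
Hypothesis hq : q != 0.
Local Notation fock := {ffun {set 'I_p} -> A}.
Implicit Types (I : {set 'I_p}) (F : fock) (r s t j : 'I_p).

(** The scalar (-q)^N, where N is the number of t in I with s < t, produced when
    e_s is moved from the right end of the product of the e_t, t in I, into its
    place in increasing order. *)
Definition crossing s I : k := \prod_(t in I) (if (s < t)%N then - q else 1).

Lemma crossing_neq0 s I : crossing s I != 0.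
Proof.
apply/prodf_neq0 => t _; case: ifP => _; rewrite ?oppr_eq0 //; exact: oner_neq0.
Qed.

Lemma crossingU1 s t I :
  t \notin I ->
  crossing s (t |: I) = (if (s < t)%N then - q else 1) * crossing s I.
Proof. exact: big_setU1. Qed.

Lemma crossingD1 s t I :
  t \in I ->
  crossing s I = (if (s < t)%N then - q else 1) * crossing s (I :\ t).
Proof. exact: big_setD1. Qed.

(** A function F stands for the sum over I of F I times e_I, where e_I is the
    increasing product of the e_t, t in I; create s is right multiplication
    by e_s. *)
Definition create s F : fock :=
  [ffun I : {set 'I_p} => if s \in I then crossing s I *: F (I :\ s) else 0].

(** The weight is chosen to make annihil j a skew derivation dual to create j:
    see annihil_create, annihil_createK and create_annihil. *)
Definition annihil j F : fock :=
  [ffun I : {set 'I_p} =>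
     if j \in I then 0 else (crossing j I)^-1 *: F (j |: I)].

Definition number j F : fock :=
  [ffun I : {set 'I_p} => (if j \in I then q else 1) *: F I].

Definition rscale (a : A) F : fock := [ffun I : {set 'I_p} => F I * a].

Fact create_is_linear s : linear (create s).
Proof.
move=> a F G; apply/ffunP => I; rewrite !ffunE.
by case: ifP; rewrite ?scaler0 ?addr0 // scalerDr !scalerA mulrC.
Qed.
HB.instance Definition _ s :=
  GRing.isLinear.Build k fock fock _ (create s) (create_is_linear s).

Fact annihil_is_linear j : linear (annihil j).
Proof.
move=> a F G; apply/ffunP => I; rewrite !ffunE.
by case: ifP; rewrite ?scaler0 ?addr0 // scalerDr !scalerA mulrC.
Qed.
HB.instance Definition _ j :=
  GRing.isLinear.Build k fock fock _ (annihil j) (annihil_is_linear j).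

Fact number_is_linear j : linear (number j).
Proof.
by move=> a F G; apply/ffunP => I; rewrite !ffunE scalerDr !scalerA mulrC.
Qed.
HB.instance Definition _ j :=
  GRing.isLinear.Build k fock fock _ (number j) (number_is_linear j).

Fact rscale_is_linear a : linear (rscale a).
Proof.
by move=> c F G; apply/ffunP => I; rewrite !ffunE mulrDl scalerAl.
Qed.
HB.instance Definition _ a :=
  GRing.isLinear.Build k fock fock _ (rscale a) (rscale_is_linear a).

Lemma rscaleD a b F : rscale (a + b) F = rscale a F + rscale b F.
Proof. by apply/ffunP => I; rewrite !ffunE mulrDr. Qed.

Lemma rscale_sum (J : finType) (f : J -> A) (S : pred J) F :
  rscale (\sum_(i | S i) f i) F = \sum_(i | S i) rscale (f i) F.
Proof.
apply/ffunP => I; rewrite sum_ffunE !ffunE mulr_sumr.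
by apply: eq_bigr => i _; rewrite ffunE.
Qed.

Lemma rscaleZ c a F : rscale (c *: a) F = c *: rscale a F.
Proof. by apply/ffunP => I; rewrite !ffunE scalerAr. Qed.

Lemma rscaleA a b F : rscale a (rscale b F) = rscale (b * a) F.
Proof. by apply/ffunP => I; rewrite !ffunE mulrA. Qed.

Lemma create_rscale s a F : create s (rscale a F) = rscale a (create s F).
Proof.
by apply/ffunP => I; rewrite !ffunE; case: ifP; rewrite ?mul0r // scalerAl.
Qed.

Lemma createK s F : create s (create s F) = 0.
Proof.
by apply/ffunP => I; rewrite !ffunE setD11; case: ifP; rewrite ?scaler0.
Qed.

Lemma createC s t F :
  (s < t)%N -> create s (create t F) = - q *: create t (create s F).
Proof.
move=> lst; have nst : s != t by rewrite neq_ltn lst.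
apply/ffunP => I; rewrite !ffunE !inE (eq_sym t s) nst /=.
have [sI|] := boolP (s \in I); have [tI|] := boolP (t \in I);
  rewrite ?scaler0 //.
rewrite !scalerA (crossingD1 s tI) (crossingD1 t sI) lst ltnNge (ltnW lst) /=
  mul1r.
by rewrite !mulrA [_ :\ s :\ t]setDDl [_ :\ t :\ s]setDDl setUC mulrAC.
Qed.

Lemma annihil_create j s F : j != s ->
  annihil j (create s F) =
  (if (s < j)%N then - q else (- q)^-1) *: create s (annihil j F).
Proof.
move=> njs; apply/ffunP => I; rewrite !ffunE !inE.
rewrite njs eq_sym (negbTE njs) /=.
have [jI|jI] := boolP (j \in I); first by case: (s \in I); rewrite ?scaler0.
have [sI|] := boolP (s \in I); last by rewrite !scaler0.
have -> : (j |: I) :\ s = j |: (I :\ s).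
  by apply/setP=> t; rewrite !inE; case: (eqVneq t j) => [->|//]; rewrite njs.
rewrite !scalerA crossingU1 // [crossing j I](crossingD1 j sI); congr (_ *: _).
have [ljs|lsj|/val_inj ejs] := ltngtP; last by rewrite ejs eqxx in njs.
  by rewrite invfM; ring.
by rewrite !mul1r; ring.
Qed.

Lemma annihil_createK j F I :
  annihil j (create j F) I = if j \in I then 0 else F I.
Proof.
rewrite !ffunE; case: ifP => // /negbT jI.
by rewrite setU11 setU1K // crossingU1 // ltnn mul1r scalerA mulVf ?scale1r
  ?crossing_neq0.
Qed.

Lemma create_annihil j F I :
  create j (annihil j F) I = if j \in I then F I else 0.
Proof.
rewrite !ffunE setD11; case: ifP => // jI.
by rewrite setD1K // {1}(crossingD1 j jI) ltnn mul1r scalerA mulfV ?scale1r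
  ?crossing_neq0.
Qed.

Lemma number_create j s F :
  number j (create s F) =
  (if s == j then q else 1) *: create s (number j F).
Proof.
apply/ffunP => I; rewrite !ffunE !inE.
have [->|nsj] := eqVneq s j.
  by case: (j \in I); rewrite ?scaler0 //= scale1r.
by rewrite /= scale1r; case: (s \in I); rewrite ?scaler0 // !scalerA mulrC.
Qed.

(** The entries of the R-matrix operator on the exterior algebra: on generators,
    hop j j multiplies e_j by q and fixes the other ones, and for r > j, hop r j
    sends e_j to (q - q^-1) e_r and the other ones to 0.  Writing the latter in
    terms of create and annihil makes its compatibility with products a
    consequence of the commutation rules above. *)
Definition hop r j F : fock :=
  if r == j then number j F
  else if (j < r)%N then (q - q^-1) *: create r (annihil j F) else 0.

Fact hop_is_linear r j : linear (hop r j).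
Proof.
move=> a F G; rewrite /hop; case: ifP => _; first exact: linearP.
case: ifP => _; last by rewrite scaler0 addr0.
by rewrite !linearP /= !scalerA mulrC.
Qed.
HB.instance Definition _ r j :=
  GRing.isLinear.Build k fock fock _ (hop r j) (hop_is_linear r j).

(** The hop operators form a twisted coproduct: hop r j of a product with e_s on
    the right is the sum over l of hop l j of the left factor times hop r l
    of e_s, and only l = r and l = s contribute. *)
Lemma hop_create r j s F :
  hop r j (create s F) =
  (if s == r then q else 1) *: create s (hop r j F) +
  (if (s < r)%N then q - q^-1 else 0) *: create r (hop s j F).
Proof.
rewrite {1 2}/hop; have [->|nrj] := eqVneq r j.
  rewrite number_create; case: ltnP => lsj; last by rewrite scale0r addr0.
  rewrite /hop -(inj_eq val_inj) ltn_eqF // ltnNge (ltnW lsj) /=.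
  by rewrite linear0 scaler0 addr0.
have [ltjr|lejr] := ltnP j r; last first.
  rewrite linear0 scaler0 add0r; case: ltnP => lsr; last by rewrite scale0r.
  have lsj := leq_trans lsr lejr.
  by rewrite /hop -(inj_eq val_inj) ltn_eqF // ltnNge (ltnW lsj) /= linear0
    scaler0.
have [->|nsr] := eqVneq s r.
  rewrite ltnn scale0r addr0 annihil_create; last by rewrite neq_ltn ltjr.
  by rewrite !linearZ /= createK !scaler0.
rewrite scale1r /hop; have [esj|nsj] := eqVneq s j.
  rewrite esj ltjr linearZ /= createC //.
  have -> : number j F = annihil j (create j F) + q *: create j (annihil j F).
    apply/ffunP => I; rewrite [in RHS]ffunE annihil_createK [X in _ + X]ffunE
      create_annihil ffunE.
    by case: ifP => _; rewrite ?scaler0 ?addr0 ?add0r ?scale1r.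
  rewrite linearD !linearZ /= scalerDr scaleNr addrCA !scalerA mulrC.
  by rewrite addNr addr0.
rewrite annihil_create; last by rewrite eq_sym.
have [lsj|lejs] := ltnP s j.
  have lsr := ltn_trans lsj ltjr.
  rewrite [(j < s)%N]ltnNge (ltnW lsj) linear0 scaler0 addr0 !linearZ /=.
  by rewrite (createC _ lsr) !scalerA mulrC.
have ltjs : (j < s)%N by rewrite ltn_neqAle lejs eq_sym (inj_eq val_inj) nsj.
rewrite ltjs !linearZ /=.
have [lsr|lrs|/val_inj esr] := ltngtP s r; last by rewrite esr eqxx in nsr.
  rewrite (createC _ lsr) !scalerA -scalerDl; congr (_ *: _).
  by field; rewrite oppr_eq0 hq.
rewrite scale0r scaler0 addr0 (createC _ lrs) !scalerA; congr (_ *: _).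
by field; rewrite oppr_eq0 hq.
Qed.

Lemma hop_rscale r j a F : hop r j (rscale a F) = rscale a (hop r j F).
Proof.
have nE : number j (rscale a F) = rscale a (number j F).
  by apply/ffunP => I; rewrite !ffunE scalerAl.
have aE : annihil j (rscale a F) = rscale a (annihil j F).
  by apply/ffunP => I; rewrite !ffunE; case: ifP; rewrite ?mul0r // scalerAl.
rewrite /hop; case: ifP => // _; case: ifP => _; last by rewrite linear0.
by rewrite aE create_rscale linearZ.
Qed.

(** Right multiplication by the row sum_s a_s e_s. *)
Definition rowmul (a : 'I_p -> A) F : fock := \sum_s rscale (a s) (create s F).

Fact rowmul_is_linear a : linear (rowmul a).
Proof.
move=> c F G; rewrite /rowmul scaler_sumr -big_split /=.
by apply: eq_bigr => s _; rewrite !linearP.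
Qed.
HB.instance Definition _ a :=
  GRing.isLinear.Build k fock fock _ (rowmul a) (rowmul_is_linear a).

Lemma rowmul_rscale a b F :
  rowmul a (rscale b F) = \sum_s rscale (b * a s) (create s F).
Proof. by apply: eq_bigr => s _; rewrite create_rscale rscaleA. Qed.

(** Since e_s squares to 0 and the e_s commute up to - q, a product of two rows
    depends only on the quantum 2 x 2 minors of their coefficients. *)
Lemma rowmulM a b F :
  rowmul b (rowmul a F) =
  \sum_(t : 'I_p) \sum_(s : 'I_p | (s < t)%N)
    rscale (a s * b t - q *: (a t * b s)) (create t (create s F)).
Proof.
rewrite /rowmul.
transitivity (\sum_t \sum_s rscale (a s * b t) (create t (create s F))).
  apply: eq_bigr => t _; rewrite !linear_sum /=; apply: eq_bigr => s _.
  by rewrite create_rscale rscaleA.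
transitivity (
  \sum_(t : 'I_p) \sum_(s : 'I_p | (s < t)%N)
    rscale (a s * b t) (create t (create s F)) +
  \sum_(s : 'I_p) \sum_(t : 'I_p | (s < t)%N)
    rscale (- (q *: (a t * b s))) (create t (create s F))).
  rewrite -big_split /=; apply: eq_bigr => t _.
  rewrite (bigID (fun s : 'I_p => (s < t)%N)) /=; congr (_ + _).
  rewrite (bigD1 t) ?ltnn //= createK linear0 add0r.
  apply: eq_big => s.
    by rewrite -leqNgt ltn_neqAle eq_sym -(inj_eq val_inj) andbC.
  rewrite -leqNgt => /andP[lets nst].
  have lts : (t < s)%N by rewrite ltn_neqAle lets eq_sym (inj_eq val_inj) nst.
  by rewrite (createC _ lts) linearZ /= -scaleNr rscaleZ.
rewrite [X in _ + X](exchange_big_dep xpredT) //= -big_split /=.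
apply: eq_bigr => t _; rewrite -big_split /=; apply: eq_bigr => s _.
by rewrite rscaleD.
Qed.
End FockSpace.

(** * Rows of a quantum matrix acting on the exterior algebra *)

Section QuantumMatrix.
Variables (k : fieldType) (q : k) (A : algType k).

(** The defining relations on a family of elements of an algebra.  They are
    abstracted from the algebra of quantum matrices because the transposed family
    satisfies them too, so that each statement on rows is available for
    columns. *)
Record quantum_matrix (m n : nat) (x : 'I_m -> 'I_n -> A) : Prop :=
  QuantumMatrix {
  qm_row : forall (i : 'I_m) (j l : 'I_n),
    (j < l)%N -> x i j * x i l = q *: (x i l * x i j);
  qm_col : forall (i t : 'I_m) (j : 'I_n),
    (i < t)%N -> x i j * x t j = q *: (x t j * x i j);
  qm_comm : forall (i t : 'I_m) (j l : 'I_n), (t < i)%N -> (j < l)%N ->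
    x i j * x t l = x t l * x i j;
  qm_cross : forall (i t : 'I_m) (j l : 'I_n), (i < t)%N -> (j < l)%N ->
    x i j * x t l = x t l * x i j + (q - q^-1) *: (x i l * x t j) }.

Lemma quantum_matrix_tr m n (x : 'I_m -> 'I_n -> A) :
  quantum_matrix x -> quantum_matrix (fun j i => x i j).
Proof.
move=> [xr xc xo xx]; split=> [i j l|i t j|i t j l ti jl|i t j l it jl].
- exact: xc.
- exact: xr.
- by rewrite [RHS]xo.
- by rewrite xx // [x l i * _]xo.
Qed.

Variables (m n : nat) (x : 'I_m -> 'I_n -> A).
Hypotheses (hq : q != 0) (hx : quantum_matrix x).
Local Notation fock := {ffun {set 'I_n} -> A}.
Local Notation hop := (hop q).
Local Notation create := (create q).
Implicit Types (F : fock) (i t : 'I_m) (j l r s : 'I_n) (w : seq 'I_m).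
Implicit Types (a b : A) (I : {set 'I_n}).

(** The relations between the entries of rows i and t in the form R T1 T2 =
    T2 T1 R, uniformly in the relative position of i, t and of j, s. *)
Lemma qm_exchange i t j s :
  (if s == j then q else 1) *: (x t s * x i j) +
    (if (j < s)%N then q - q^-1 else 0) *: (x t j * x i s) =
  (if t == i then q else 1) *: (x i j * x t s) +
    (if (t < i)%N then q - q^-1 else 0) *: (x t j * x i s).
Proof.
have [xr xc xo xx] := hx.
have qB : 1 + q * (q - q^-1) = q * q by field.
have [lti|lit|/val_inj <-] := ltngtP t i; last first.
- rewrite eqxx scale0r addr0; have [ljs|lsj|/val_inj <-] := ltngtP j s.
  + rewrite (xr _ _ _ ljs) -(inj_eq val_inj) gtn_eqF // scale1r !scalerA.
    by rewrite -{1}[x _ s * _]scale1r -scalerDl -qB mulrC.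
  + by rewrite (xr _ _ _ lsj) -(inj_eq val_inj) ltn_eqF // scale1r scale0r
      addr0.
  + by rewrite eqxx scale0r addr0.
- rewrite scale0r addr0 -[t == i](inj_eq val_inj) gtn_eqF // scale1r.
  have [ljs|lsj|/val_inj <-] := ltngtP j s.
  + by rewrite -(inj_eq val_inj) gtn_eqF // scale1r (xx _ _ _ _ lit ljs) [x t j
      * _]xo.
  + by rewrite -(inj_eq val_inj) ltn_eqF // scale1r scale0r addr0 xo.
  + by rewrite eqxx scale0r addr0 (xc _ _ _ lit).
- rewrite -[t == i](inj_eq val_inj) ltn_eqF // scale1r.
  have [ljs|lsj|/val_inj <-] := ltngtP j s.
  + by rewrite -(inj_eq val_inj) gtn_eqF // scale1r [x i j * _]xo.
  + by rewrite -(inj_eq val_inj) ltn_eqF // scale1r scale0r addr0 (xx _ _ _ _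
      lti lsj).
  + rewrite eqxx scale0r addr0 (xc _ _ _ lti) !scalerA.
    by rewrite -{2}[x i _ * _]scale1r -scalerDl -qB mulrC.
Qed.

(** What x i j F becomes when the entry is carried to the right of F, up to a
    scalar and to exchanges of rows: the hop operators act on F while the column
    index of the entry moves from j to r. *)
Definition transfer i j F : fock := \sum_r rscale (x i r) (hop r j F).

(** The coproduct of the hop operators turns qm_exchange into a rule for moving an
    entry of row i past row t.  The last term, in which the two rows trade
    places, only occurs for t < i. *)
Lemma transfer_rowmul i t j F :
  transfer i j (rowmul q (x t) F) =
  (if t == i then q else 1) *: rowmul q (x t) (transfer i j F) +
  (if (t < i)%N then q - q^-1 else 0) *: rowmul q (x i) (transfer t j F).
Proof.
have mul_transfer i1 t1 : rowmul q (x t1) (transfer i1 j F) =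
    \sum_r \sum_s rscale (x i1 r * x t1 s) (create s (hop r j F)).
  by rewrite linear_sum; apply: eq_bigr => r _; rewrite /= rowmul_rscale.
rewrite !mul_transfer !scaler_sumr -big_split /=.
transitivity (\sum_r \sum_s
    (rscale ((if s == r then q else 1) *: (x t s * x i r))
       (create s (hop r j F)) +
     rscale ((if (s < r)%N then q - q^-1 else 0) *: (x t s * x i r))
       (create r (hop s j F)))).
  apply: eq_bigr => r _; rewrite /rowmul !linear_sum /=.
  apply: eq_bigr => s _.
  by rewrite hop_rscale rscaleA hop_create // linearD !linearZ /= !rscaleZ.
transitivity (\sum_r \sum_s
    rscale ((if s == r then q else 1) *: (x t s * x i r) +
            (if (r < s)%N then q - q^-1 else 0) *: (x t r * x i s))
       (create s (hop r j F))).
  under eq_bigr do rewrite big_split /=.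
  rewrite big_split /= [X in _ + X]exchange_big -big_split /=.
  apply: eq_bigr => r _; rewrite -big_split /=.
  by apply: eq_bigr => s _; rewrite rscaleD.
apply: eq_bigr => r _; rewrite !scaler_sumr -big_split /=.
by apply: eq_bigr => s _; rewrite qm_exchange rscaleD !rscaleZ.
Qed.

Lemma rowmul_sq i F : rowmul q (x i) (rowmul q (x i) F) = 0.
Proof.
rewrite rowmulM // big1 // => t _; rewrite big1 // => s lst.
by rewrite (qm_row hx) // subrr; apply/ffunP => I; rewrite !ffunE mulr0.
Qed.

Lemma rowmul_lt i t F : (i < t)%N ->
  rowmul q (x t) (rowmul q (x i) F) =
  - q^-1 *: rowmul q (x i) (rowmul q (x t) F).
Proof.
move=> lit; rewrite !rowmulM // scaler_sumr; apply: eq_bigr => l _.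
rewrite scaler_sumr; apply: eq_bigr => j ljl; rewrite -rscaleZ; congr rscale.
rewrite (qm_cross hx) // [x t j * _](qm_comm hx) //.
rewrite -addrA -scalerBl addrAC subrr add0r addrC.
by rewrite scalerBr scalerA mulNr mulVf // scaleN1r opprK.
Qed.

Lemma rowmulC i t : i != t -> exists2 c, c != 0 & forall F,
  rowmul q (x t) (rowmul q (x i) F) = c *: rowmul q (x i) (rowmul q (x t) F).
Proof.
have nq : - q^-1 != 0 by rewrite oppr_eq0 invr_eq0.
rewrite neq_ltn => /orP[lit|lti].
  by exists (- q^-1) => // F; rewrite rowmul_lt.
exists (- q^-1)^-1 => [|F]; first by rewrite invr_eq0.
by rewrite [in RHS]rowmul_lt // scalerA mulVf // scale1r.
Qed.

Definition rowprod (w : seq 'I_m) F : fock :=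
  foldl (fun G i => rowmul q (x i) G) F w.

Fact rowprod_is_linear w : linear (rowprod w).
Proof.
by elim: w => [|i w IHw] a F G //=; rewrite linearP; apply: IHw.
Qed.
HB.instance Definition _ w :=
  GRing.isLinear.Build k fock fock _ (rowprod w) (rowprod_is_linear w).

Lemma rowprod_cat w1 w2 F : rowprod (w1 ++ w2) F = rowprod w2 (rowprod w1 F).
Proof. exact: foldl_cat. Qed.

Lemma rowprod_rcons w i F :
  rowprod (rcons w i) F = rowmul q (x i) (rowprod w F).
Proof. exact: foldl_rcons. Qed.

Lemma rowprod_front w i : i \notin w -> exists2 c, c != 0 & forall F,
  rowprod (rcons w i) F = c *: rowprod (i :: w) F.
Proof.
elim: w => [_|t w IHw]; first by exists 1 => [|F]; rewrite ?oner_eq0 ?scale1r.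
rewrite inE negb_or eq_sym => /andP[nit /IHw[c c0 wE]].
have [d d0 dE] := rowmulC nit.
exists (c * d) => [|F]; first by rewrite mulf_neq0.
by move: (wE (rowmul q (x t) F)) => /= ->; rewrite dE linearZ /= scalerA.
Qed.

(** A repeated row can be moved next to its first occurrence, at the cost of
    nonzero scalars, where its square vanishes. *)
Lemma rowprod_mem w i F : i \in w -> rowprod w (rowmul q (x i) F) = 0.
Proof.
elim: w F => // t w IHw F; rewrite inE /=; case: eqVneq => [->|nit] /= iw.
  by rewrite rowmul_sq linear0.
by have [c _ ->] := rowmulC nit; rewrite linearZ /= IHw // scaler0.
Qed.

Lemma rowprod_nuniq w F : ~~ uniq w -> rowprod w F = 0.
Proof.
elim: w F => //= i w IHw F; rewrite negb_and negbK => /orP[/rowprod_mem //|].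
exact: IHw.
Qed.

Lemma rowprod_perm w w' : uniq w -> perm_eq w w' -> exists2 c, c != 0 &
  forall F, rowprod w F = c *: rowprod w' F.
Proof.
elim: w' w => [|i w' IHw'] w uw eqw.
  rewrite (perm_nilP eqw); exists 1 => [|F]; rewrite ?oner_eq0 ?scale1r //.
have iw : i \in w by rewrite (perm_mem eqw) mem_head.
case/splitPr: iw uw eqw => w1 w2 uw eqw.
have iw1 : i \notin w1.
  by move: uw; rewrite cat_uniq => /and3P[_ /norP[]].
have [c c0 cE] := rowprod_front iw1.
have eqw' : perm_eq (w1 ++ w2) w'.
  by rewrite -(perm_cons i) -cat1s perm_catCA.
have uw' : uniq (w1 ++ w2).
  rewrite (perm_uniq eqw'); move: uw; rewrite (perm_uniq eqw) /=.
  by case/andP.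
have [d d0 dE] := IHw' _ uw' eqw'.
exists (c * d) => [|F]; first by rewrite mulf_neq0.
rewrite -cat_rcons rowprod_cat cE linearZ /= -rowprod_cat dE.
by rewrite scalerA.
Qed.

(** The element a of the coefficient algebra times the unit of the exterior
    algebra. *)
Definition vac a : fock := [ffun I : {set 'I_n} => if I == set0 then a else 0].

Fact vac_is_linear : linear vac.
Proof.
move=> c a b; apply/ffunP => I; rewrite !ffunE.
by case: ifP; rewrite ?scaler0 ?addr0.
Qed.
HB.instance Definition _ :=
  GRing.isLinear.Build k A fock _ vac vac_is_linear.

Definition lscale a F : fock := [ffun I => a * F I].

Lemma rscale_vac a b : rscale b (vac a) = vac (a * b).
Proof. by apply/ffunP => I; rewrite !ffunE; case: ifP; rewrite ?mul0r. Qed.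

Lemma lscale_vac a b : lscale b (vac a) = vac (b * a).
Proof. by apply/ffunP => I; rewrite !ffunE; case: ifP; rewrite ?mulr0. Qed.

Fact lscale_is_linear a : linear (lscale a).
Proof.
by move=> c F G; apply/ffunP => I; rewrite !ffunE mulrDr scalerAr.
Qed.
HB.instance Definition _ a :=
  GRing.isLinear.Build k fock fock _ (lscale a) (lscale_is_linear a).

Lemma rowprod_lscale w a F : rowprod w (lscale a F) = lscale a (rowprod w F).
Proof.
elim: w F => //= i w IHw F; rewrite -IHw; congr rowprod.
rewrite linear_sum; apply: eq_bigr => s _.
apply/ffunP => I; rewrite !ffunE; case: ifP => _; last by rewrite mul0r mulr0.
by rewrite scalerAr mulrA.
Qed.

Lemma transfer_vac i j a : transfer i j (vac a) = vac (a * x i j).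
Proof.
rewrite /transfer (bigD1 j) //= big1 ?addr0 => [|r nrj].
  rewrite /hop eqxx -rscale_vac; congr rscale; apply/ffunP => I; rewrite !ffunE.
  by case: eqP => [->|_]; rewrite ?inE ?scale1r // scaler0.
rewrite /hop (negbTE nrj); case: ifP => _; last by rewrite linear0.
rewrite (_ : annihil q j _ = 0) ?linear0 ?scaler0 ?linear0 //.
apply/ffunP => I; rewrite !ffunE; case: ifP => // _.
by rewrite -subset0 subUset sub1set inE scaler0.
Qed.

(** The product y_1 ... y_m of all the rows; its coefficients are the maximal
    minors (row_top_minor). *)
Definition row_top : fock := rowprod (enum 'I_m) (vac 1).

(** The source of the Cramer rule: row i already occurs in the product. *)
Lemma rowmul_row_top i : rowmul q (x i) row_top = 0.
Proof.
by rewrite -rowprod_rcons rowprod_nuniq // rcons_uniq mem_enum.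
Qed.

(** With row i in the last position, every term in which row i is exchanged with
    an earlier row contains row i twice and vanishes. *)
Lemma transfer_rowprod i j w F : i \notin w ->
  rowprod (rcons w i) (transfer i j F) =
  q^-1 *: transfer i j (rowprod (rcons w i) F).
Proof.
elim: w F => [F _|t w IHw F] /=.
  by rewrite transfer_rowmul eqxx ltnn scale0r addr0 scalerA mulVf // scale1r.
rewrite inE negb_or eq_sym => /andP[nti iw].
have := transfer_rowmul i t j F; rewrite (negbTE nti) scale1r => PE.
rewrite -IHw // PE linearD linearZ /=.
by rewrite [in X in _ + X]rowprod_mem ?mem_rcons ?mem_head // scaler0 addr0.
Qed.

Lemma lscale_row_top i j :
  lscale (x i j) row_top = q^-1 *: transfer i j row_top.
Proof.
(* Row i is moved to the end, so that transfer_rowprod applies. *)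
have pE : perm_eq (enum 'I_m) (rcons (rem i (enum 'I_m)) i).
  by rewrite perm_sym perm_rcons perm_sym perm_to_rem // mem_enum.
have [c _ cE] := rowprod_perm (enum_uniq _) pE.
have Pic d F : transfer i j (d *: F) = d *: transfer i j F.
  by rewrite /transfer scaler_sumr; apply: eq_bigr => r _; rewrite !linearZ.
rewrite /row_top -rowprod_lscale lscale_vac mulr1 -[x i j]mul1r -transfer_vac
  !cE.
rewrite transfer_rowprod ?mem_rem_uniq ?enum_uniq ?inE ?eqxx //.
by rewrite Pic !scalerA mulrC.
Qed.
End QuantumMatrix.

Lemma rowmulE (k : fieldType) (q : k) (A : algType k) p (a : 'I_p -> A) F K :
  rowmul q a F K = \sum_(s in K) (crossing q s K *: F (K :\ s)) * a s.
Proof.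
rewrite /rowmul sum_ffunE [RHS]big_mkcond /=; apply: eq_bigr => s _;
  rewrite !ffunE.
by case: ifP => _ //; rewrite mul0r.
Qed.

Lemma set_rem (T : finType) (s : T) w :
  uniq w -> [set t in w] :\ s = [set t in rem s w].
Proof. by move=> uw; apply/setP => t; rewrite !inE mem_rem_uniq // inE. Qed.

(** * Maximal minors: row and column expansions, exchange, commutation *)

Section Minors.
Variables (k : fieldType) (q : k) (A : algType k) (m n : nat).
Variable x : 'I_m -> 'I_n -> A.
Hypotheses (hq : q != 0) (hx : quantum_matrix q x).
Local Notation xT := (fun j i => x i j).
Let hxT : quantum_matrix q xT := quantum_matrix_tr hx.
Implicit Types (F : {ffun {set 'I_m} -> A}) (K L : {set 'I_n}).

Definition increasing p : rel 'I_p := fun i j => (i < j)%N.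

Lemma increasing_uniq p (w : seq 'I_p) : pairwise (@increasing p) w -> uniq w.
Proof. by apply: pairwise_uniq => i; apply: ltnn. Qed.

Lemma increasing_rem p (w : seq 'I_p) s :
  pairwise (@increasing p) w -> pairwise (@increasing p) (rem s w).
Proof. exact/subseq_pairwise/rem_subseq. Qed.

Lemma crossing_rcons_max p (w : seq 'I_p) r : all ((@increasing p)^~ r) w ->
  crossing q r [set t in rcons w r] = 1.
Proof.
move=> /allP wr; rewrite /crossing big1 // => t; rewrite inE mem_rcons inE.
by case/orP=> [/eqP->|/wr ltr]; rewrite ?ltnn // ltnNge (ltnW ltr).
Qed.

Lemma set_rcons p (w : seq 'I_p) r :
  [set t in rcons w r] = r |: [set t in w].
Proof. by apply/setP => t; rewrite !inE mem_rcons inE. Qed.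

Lemma vac_rcons p (w : seq 'I_p) r :
  vac _ (1 : A) [set t in rcons w r] = 0.
Proof.
by rewrite ffunE set_rcons -subset0 subUset sub1set inE.
Qed.

(** Expanding along the last row or along the last column gives the same minors.
    Both sides satisfy the same double recursion on the largest row r and the
    largest column l: entries x r s and x t l with t < r and s < l commute, so the
    two factors may be split off in either order. *)
Lemma rowprod_colprod (u : seq 'I_m) (w : seq 'I_n) :
  pairwise (@increasing m) u -> pairwise (@increasing n) w ->
  rowprod q x u (vac _ 1) [set j in w] = rowprod q xT w (vac _ 1) [set i in u].
Proof.
have [N] := ubnP (size u); elim: N => // N IHN in u w *.
have set_nil p : [set t : 'I_p in [::]] = set0 by apply/setP => t; rewrite !inE.
case/lastP: u => [_|u r].
  case/lastP: w => [_ _|w l _ _]; first by rewrite /= !set_nil !ffunE !eqxx.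
  by rewrite rowprod_rcons rowmulE set_nil big_set0 vac_rcons.
case/lastP: w => [_ _ _|w l].
  by rewrite rowprod_rcons rowmulE set_nil big_set0 vac_rcons.
rewrite size_rcons ltnS !pairwise_rcons => ltuN /andP[ur iu] /andP[wl iw].
have [uu uw] := (increasing_uniq iu, increasing_uniq iw).
have ru : r \notin u by apply/negP => /(allP ur); rewrite /increasing ltnn.
have lw : l \notin w by apply/negP => /(allP wl); rewrite /increasing ltnn.
rewrite !rowprod_rcons !rowmulE.
(* The terms of the corner entry x r l agree by induction; what remains are
   the terms that split off two distinct entries of row r and column l. *)
rewrite (bigD1 l) ?inE ?mem_rcons ?mem_head //= [RHS](bigD1 r) ?inE ?mem_rcons
  ?mem_head //=.
rewrite !crossing_rcons_max // !scale1r !set_rcons !setU1K ?inE // IHN //.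
congr (_ + _).
have setD1_rcons p (v : seq 'I_p) e f : uniq v -> e != f ->
    (f |: [set t in v]) :\ e = [set t in rcons (rem e v) f].
  move=> uv nef; rewrite set_rcons -set_rem //; apply/setP => t; rewrite !inE.
  by case: eqVneq => // ->; rewrite (negbTE nef).
transitivity (\sum_(s in [set j in w]) \sum_(t in [set i in u])
   (- q * crossing q s [set j in w] * crossing q t [set i in u]) *:
    (rowprod q x (rem t u) (vac _ 1) [set j in rem s w] * (x r s * x t l))).
  apply: eq_big => [s|s].
    by rewrite !inE; case: eqVneq => [->|_]; rewrite ?(negbTE lw) ?andbT.
  rewrite !inE; case: eqVneq => //= nsl; rewrite andbT => sw.
  have lsl := allP wl _ sw.
  rewrite crossingU1 ?inE // (lsl : (s < l)%N) setD1_rcons // (IHN u) //;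
    last first.
    rewrite pairwise_rcons increasing_rem // andbT.
    by apply/allP => t /mem_rem; apply: (allP wl).
  rewrite rowprod_rcons rowmulE scaler_sumr mulr_suml; apply: eq_bigr => t.
  rewrite inE => tu; have ltr := allP ur _ tu.
  rewrite set_rem // -IHN ?increasing_rem //; last first.
    by rewrite (leq_ltn_trans _ ltuN) // size_rem // leq_pred.
  by rewrite -!scalerAl !scalerA -mulrA (qm_comm hx).
rewrite exchange_big /=; apply: esym; apply: eq_big => [t|t].
  by rewrite !inE; case: eqVneq => [->|_]; rewrite ?(negbTE ru) ?andbT.
rewrite !inE; case: eqVneq => //= ntr; rewrite andbT => tu.
have ltr := allP ur _ tu.
rewrite crossingU1 ?inE // (ltr : (t < r)%N) setD1_rcons // -IHN //; last first.
- rewrite pairwise_rcons increasing_rem // andbT.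
  by apply/allP => s /mem_rem; apply: (allP ur).
- rewrite size_rcons size_rem // prednK //.
  by case: (u) tu.
rewrite rowprod_rcons rowmulE scaler_sumr mulr_suml; apply: eq_bigr => s.
rewrite inE => sw; rewrite set_rem // -!scalerAl scalerA -mulrA.
by congr (_ *: _); ring.
Qed.

(** The minor with all the rows and the columns in K, as the top coefficient of
    the increasing product of the columns. *)
Definition minor K : A := rowprod q xT (enum K) (vac m 1) [set: 'I_m].

Lemma enum_increasing p (K : {set 'I_p}) : pairwise (@increasing p) (enum K).
Proof.
have : pairwise (@increasing p) (enum 'I_p).
  by have := iota_ltn_sorted 0 p;
    rewrite (sorted_pairwise ltn_trans) -val_enum_ord pairwise_map.
by apply: subseq_pairwise; rewrite {1}enumT; apply: filter_subseq.
Qed.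

Lemma row_top_minor K : row_top q x K = minor K.
Proof.
rewrite /row_top /minor -[K in LHS]set_enum rowprod_colprod ?enum_increasing //.
  by congr (rowprod _ _ _ _ _); apply/setP => i; rewrite !inE mem_enum.
by have := enum_increasing [set: 'I_m]; rewrite enum_setT -enumT.
Qed.

Lemma minor_cramer i K :
  \sum_(s in K) (crossing q s K *: minor (K :\ s)) * x i s = 0.
Proof.
have /ffunP/(_ K) := rowmul_row_top hq hx i; rewrite rowmulE ffunE.
move=> cramer; rewrite -[RHS]cramer.
by apply: eq_bigr => s _; rewrite row_top_minor.
Qed.

(** The scalars c and d do not depend on the row i: this is what allows the
    identity to be applied to the whole column z_j in colprod_comm. *)
Lemma minor_comm_entry K j : exists2 c, c != 0 & exists d : 'I_n -> k, forall i,
  x i j * minor K = c *: (minor K * x i j) +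
    \sum_(r in K | (j \notin K) && (j < r)%N)
      d r *: (minor (j |: (K :\ r)) * x i r).
Proof.
exists (q^-1 * (if j \in K then q else 1)).
  by rewrite mulf_neq0 ?invr_eq0 //; case: ifP => // _; exact: oner_neq0.
exists (fun r => q^-1 * (q - q^-1) * crossing q r K * (crossing q j (K :\
  r))^-1) => i.
have /ffunP/(_ K) := lscale_row_top hq hx i j.
rewrite !ffunE row_top_minor => ->; rewrite sum_ffunE (bigD1 j) //= scalerDr.
congr (_ + _).
  by rewrite ffunE /hop eqxx ffunE row_top_minor -scalerAl scalerA.
rewrite scaler_sumr (bigID (fun r : 'I_n => [&& r \in K, j \notin K & (j <
  r)%N])).
rewrite /= [X in _ + X]big1 ?addr0 => [|r /andP[nrj]].
  apply: eq_big => [r|r /andP[nrj /and3P[rK jK jr]]].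
    by rewrite andb_idl // => /and3P[_ _]; rewrite neq_ltn => ->; rewrite orbT.
  rewrite ffunE /hop (negbTE nrj) jr !ffunE rK !inE eq_sym (negbTE nrj) (negbTE
    jK).
  by rewrite row_top_minor -!scalerAl !scalerA !mulrA.
rewrite ffunE /hop (negbTE nrj); case: ltnP => [jr|_ _]; last first.
  by rewrite ffunE mul0r scaler0.
rewrite andbT !ffunE; case: (r \in K) => /= [/negPn jK|_]; last first.
  by rewrite scaler0 mul0r scaler0.
by rewrite !inE eq_sym nrj jK !scaler0 mul0r scaler0.
Qed.

(** Columns commute up to nonzero scalars, so an unordered product of distinct
    columns is a multiple of a minor. *)
Lemma colprod_minor w : uniq w -> exists2 c, c != 0 &
  rowprod q xT w (vac m 1) [set: 'I_m] = c *: minor [set j in w].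
Proof.
move=> uw; have [|c c0 cE] := rowprod_perm hq hxT uw (w' := enum [set j in w]).
  by apply: uniq_perm; rewrite ?enum_uniq // => j; rewrite mem_enum inE.
by exists c => //; rewrite cE ffunE.
Qed.

Lemma lscale_colprod w a :
  rowprod q xT w (vac m a) [set: 'I_m] =
  a * rowprod q xT w (vac m 1) [set: 'I_m].
Proof.
by have := rowprod_lscale q xT w a (vac m 1); rewrite lscale_vac mulr1 => ->;
  rewrite ffunE.
Qed.

(** The Cramer rule holds in every row, hence for columns, and may be multiplied
    by further columns on the right. *)
Lemma colprod_cramer w K :
  \sum_(s in K) crossing q s K *:
    (minor (K :\ s) * rowprod q xT (s :: w) (vac m 1) [set: 'I_m]) = 0.
Proof.
transitivity (rowprod q xT w
  (\sum_(s in K) crossing q s K *: rowmul q (xT s) (vac m (minor (K :\ s))))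
    [set: 'I_m]).
  rewrite linear_sum sum_ffunE; apply: eq_bigr => s _.
  by rewrite linearZ ffunE -lscale_colprod.
rewrite (_ : \sum_(s in K) _ = 0) ?linear0 ?ffunE //.
transitivity (\sum_i create q i
    (vac m (\sum_(s in K) (crossing q s K *: minor (K :\ s)) * x i s)));
      last first.
  by rewrite big1 // => i _; rewrite minor_cramer !linear0.
under [RHS]eq_bigr do rewrite !linear_sum /=.
rewrite exchange_big /=; apply: eq_bigr => s _; rewrite scaler_sumr.
apply: eq_bigr => i _.
by rewrite -create_rscale rscale_vac -scalerAl !linearZ.
Qed.

(** The statements below express that a vector is a linear combination of given
    ones by its membership in every subspace that contains them; this keeps the
    scalars implicit. *)
Definition subspace (V : lmodType k) (W : V -> Prop) : Prop :=
  W 0 /\ forall c u v, W u -> W v -> W (c *: u + v).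

Lemma subspaceZ (V : lmodType k) (W : V -> Prop) c u :
  subspace W -> W u -> W (c *: u).
Proof. by move=> [W0 WP] Wu; rewrite -[_ *: _]addr0; apply: WP. Qed.

Lemma subspaceD (V : lmodType k) (W : V -> Prop) u v :
  subspace W -> W u -> W v -> W (u + v).
Proof. by move=> [W0 WP] Wu Wv; rewrite -[u]scale1r; apply: WP. Qed.

Lemma subspace_sum (V : lmodType k) (W : V -> Prop) (J : finType)
    (S : pred J) (f : J -> V) : subspace W -> (forall i, S i -> W (f i)) ->
  W (\sum_(i | S i) f i).
Proof.
by move=> sW Wf; elim/big_ind: _ => //; [case: sW|move=> u v; apply: subspaceD].
Qed.

Lemma subspace_preim (V U : lmodType k) (f : {linear V -> U}) (W : U -> Prop) :
  subspace W -> subspace (fun v => W (f v)).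
Proof. by case=> W0 WP; split=> [|c u v Wu Wv]; rewrite (linear0, linearP) //;
  apply: WP. Qed.

(** This is the Cramer rule for the columns K and a, multiplied by the columns of
    L other than a: the term of a is a nonzero multiple of minor K * minor L, and
    the term of b vanishes when b is a column of L other than a. *)
Lemma minor_exchange K L a (W : A -> Prop) : subspace W ->
  a \in L -> a \notin K ->
  (forall b, b \in K -> b \notin L ->
     W (minor (a |: (K :\ b)) * minor (b |: (L :\ a)))) ->
  W (minor K * minor L).
Proof.
move=> sW aL aK Wab; pose w := enum (L :\ a).
have cw s : s \notin L :\ a -> exists2 c, c != 0 &
    rowprod q xT (s :: w) (vac m 1) [set: 'I_m] = c *: minor (s |: (L :\ a)).
  move=> sL; have [|c c0 ->] := @colprod_minor (s :: w).
    by rewrite /= mem_enum sL enum_uniq.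
  by exists c => //; congr (_ *: minor _); apply/setP => t;
    rewrite !inE mem_enum !inE.
have := colprod_cramer w (a |: K); rewrite big_setU1 //= setU1K //.
have [|c c0 ->] := cw a; first by rewrite !inE eqxx.
rewrite setD1K // -scalerAr scalerA => /eqP; rewrite addr_eq0 => /eqP cE.
have c1 : crossing q a (a |: K) * c != 0 by rewrite mulf_neq0 ?crossing_neq0.
rewrite -[_ * _](scalerK c1) cE; apply: subspaceZ => //.
rewrite -scaleN1r; apply: subspaceZ => //; apply: subspace_sum => // b bK.
apply: subspaceZ => //; have nba : b != a by apply: contraNneq aK => <-.
have [bL|bL] := boolP (b \in L).
  have nuw : ~~ uniq (b :: w) by rewrite /= mem_enum !inE nba bL.
  have /= -> := rowprod_nuniq hq hxT (vac m 1) nuw.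
  by rewrite ffunE mulr0; case: sW.
have [|d d0 /= ->] := cw b; first by rewrite !inE (negbTE bL) andbF.
rewrite -scalerAr; apply: subspaceZ => //.
rewrite (_ : (a |: K) :\ b = a |: (K :\ b)); first exact: Wab.
by apply/setP => t; rewrite !inE; case: (eqVneq t a) => [->|//];
  rewrite eq_sym nba.
Qed.

Definition weight p (K : {set 'I_p}) : nat := \sum_(i in K) i.

Lemma weight_replace p (K : {set 'I_p}) (r j : 'I_p) :
  r \in K -> (j < r)%N -> (weight (j |: (K :\ r)) < weight K)%N.
Proof.
move=> rK jr; rewrite /weight [X in (_ < X)%N](big_setD1 r) //=.
have [jK|jK] := boolP (j \in K :\ r).
  rewrite (setUidPr _) ?sub1set // -[X in (X < _)%N]add0n ltn_add2r.
  exact: leq_ltn_trans jr.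
by rewrite big_setU1 //= ltn_add2r.
Qed.

(** A minor is carried past the columns of w from right to left.  Each passage
    either leaves K unchanged or replaces an element of K by a smaller one, so K
    comes out unchanged only along the leading term. *)
Lemma colprod_comm w K : exists2 c, c != 0 & forall F W, subspace W ->
  (forall w' K', size w' = size w -> #|K'| = #|K| ->
     (weight K' < weight K)%N ->
     W (rowprod q xT w' (rscale (minor K') F))) ->
  W (rscale (minor K) (rowprod q xT w F) -
     c *: rowprod q xT w (rscale (minor K) F)).
Proof.
elim/last_ind: w K => [|w j IHw] K.
  by exists 1 => [|F W [W0 _] _]; rewrite ?oner_neq0 // scale1r subrr.
have [c0 c0n [d dE]] := minor_comm_entry K j.
have [c1 c1n c1E] := IHw K.
have mE G : rscale (minor K) (rowmul q (xT j) G) =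
    c0 *: rowmul q (xT j) (rscale (minor K) G) +
    \sum_(r in K | (j \notin K) && (j < r)%N) d r *:
      rowmul q (xT r) (rscale (minor (j |: (K :\ r))) G).
  rewrite {1}/rowmul linear_sum /=.
  under eq_bigr do rewrite rscaleA dE rscaleD rscaleZ rscale_sum.
  rewrite big_split /= -scaler_sumr -rowmul_rscale exchange_big /=.
  congr (_ + _); apply: eq_bigr => r _; rewrite rowmul_rscale scaler_sumr.
  by apply: eq_bigr => i _; rewrite rscaleZ.
exists (c0 * c1) => [|F W sW WF]; first by rewrite mulf_neq0.
rewrite !rowprod_rcons mE addrAC -scalerA -scalerBr.
have Wj := subspace_preim (rowmul q (xT j)) sW.
apply: subspaceD => //.
  apply: subspaceZ => //.
  have := c1E F _ Wj; rewrite linearB linearZ /=; apply=> w' K' sw' cK ltK.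
  by rewrite -rowprod_rcons; apply: WF; rewrite ?size_rcons ?sw'.
apply: subspace_sum => // r /and3P[rK jK jr]; apply: subspaceZ => //.
have ltr := weight_replace rK jr; set K1 := j |: _ in ltr *.
have cK1 : #|K1| = #|K|.
  by rewrite cardsU1 !inE (negbTE jK) andbF [RHS](cardsD1 r) rK.
have Wr := subspace_preim (rowmul q (xT r)) sW.
have [c2 c2n c2E] := IHw K1.
rewrite -[rscale _ _](subrK (c2 *: rowprod q xT w (rscale (minor K1) F))).
rewrite linearD; apply: subspaceD => //.
  apply: (c2E F _ Wr) => w' K' sw' cK ltK /=.
  by rewrite -rowprod_rcons; apply: WF;
    rewrite ?size_rcons ?sw' ?cK // (ltn_trans ltK).
rewrite linearZ /=; apply: subspaceZ => //; rewrite -rowprod_rcons.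
by apply: WF; rewrite ?size_rcons.
Qed.

(** The top coefficient of colprod_comm for the columns of L. *)
Lemma minor_comm K L : exists2 c, c != 0 & forall W, subspace W ->
  (forall K' L', #|K'| = #|K| -> #|L'| = #|L| ->
     (weight K' < weight K)%N ->
     W (minor K' * minor L')) ->
  W (minor L * minor K - c *: (minor K * minor L)).
Proof.
have [c c0 cE] := colprod_comm (enum L) K; exists c => // W sW WK.
(* Top coefficients turn the subspace W into a subspace of the Fock space. *)
pose top (F : {ffun {set 'I_m} -> A}) := F [set: 'I_m].
have sWt : subspace (fun F => W (top F)).
  case: sW => W0 WP; split=> [|a F G WF WG]; first by rewrite /top ffunE.
  by rewrite /top !ffunE; apply: WP.
have := cE (vac m 1) _ sWt;
  rewrite /top !rscale_vac mul1r !ffunE (lscale_colprod _ (minor K)).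
apply=> w' K' sw' cK ltK.
rewrite rscale_vac mul1r (lscale_colprod _ (minor K')).
have [uw|/(rowprod_nuniq hq hxT)->] := boolP (uniq w'); last first.
  by rewrite ffunE mulr0; case: sW.
have [d d0 ->] := colprod_minor uw; rewrite -scalerAr; apply: subspaceZ => //.
by apply: WK => //; rewrite cardsE (card_uniqP uw) sw' cardE.
Qed.
End Minors.

(** * The permutation expansion of a minor *)

Section Leibniz.
Variables (k : fieldType) (q : k) (A : algType k) (m n : nat).
Variable x : 'I_m -> 'I_n -> A.
Local Notation xT := (fun j i => x i j).
Implicit Types (F : {ffun {set 'I_m} -> A}).

Definition createword (u : seq 'I_m) F := foldl (fun G i => create q i G) F u.

Lemma createword_rscale u a F :
  createword u (rscale a F) = rscale a (createword u F).
Proof. by elim: u F => //= i u IHu F; rewrite -IHu create_rscale. Qed.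

Lemma colprod_expand N w F : size w = N ->
  rowprod q xT w F = \sum_(u : N.-tuple 'I_m)
    rscale (\prod_(p <- zip u w) x p.1 p.2) (createword u F).
Proof.
elim: w N F => [|j w IHw] [|N] F //=.
  move=> _; rewrite (big_pred1 [tuple]) => [|u]; last exact/esym/eqP/tuple0.
  by rewrite big_nil; apply/ffunP => I; rewrite !ffunE mulr1.
move=> [sw]; rewrite [rowmul _ _ _]/rowmul linear_sum /=.
transitivity (\sum_i \sum_(u : N.-tuple 'I_m)
    rscale (\prod_(p <- zip (i :: u) (j :: w)) x p.1 p.2) (createword (i :: u)
      F)).
  apply: eq_bigr => i _; rewrite (IHw N) //; apply: eq_bigr => u _.
  by rewrite /= big_cons /= -rscaleA createword_rscale.
rewrite pair_big /=.
rewrite (reindex (fun p : 'I_m * N.-tuple 'I_m => [tuple of p.1 :: p.2])) //=.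
exists (fun u => (thead u, [tuple of behead u])) => [[i u] _|u _] /=.
  by rewrite theadE; congr (_, _); apply: val_inj.
by rewrite [RHS]tuple_eta.
Qed.

Definition inversions (u : seq nat) : nat :=
  \sum_(b < size u) \sum_(a < size u) ((a < b) && (nth 0 u b < nth 0 u a))%N.

Lemma inversions_rcons u t :
  inversions (rcons u t) = (inversions u + count (ltn t) u)%N.
Proof.
rewrite /inversions size_rcons big_ord_recr /=; congr (_ + _)%N.
  apply: eq_bigr => b _; rewrite big_ord_recr /= ltnNge (ltnW (ltn_ord b))
    addn0.
  by apply: eq_bigr => a _; rewrite !nth_rcons !ltn_ord.
rewrite big_ord_recr /= ltnn addn0 -sum1_count (big_nth 0%N) big_mkord
  [RHS]big_mkcond.
by apply: eq_bigr => a _; rewrite !nth_rcons ltnn eqxx !ltn_ord /=; case: ifP.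
Qed.

(** Reordering a word of distinct generators costs a factor - q per inversion. *)
Lemma createword_vac u :
  createword u (vac m 1) =
  [ffun I => if uniq u && (I == [set i in u])
             then (- q) ^+ inversions (map val u) *: 1 else 0].
Proof.
elim/last_ind: u => [|u t IHu].
  apply/ffunP => I; rewrite !ffunE /inversions big_ord0 expr0 scale1r /=.
  by congr (if I == _ then _ else _); apply/setP => i; rewrite !inE.
rewrite /createword foldl_rcons -/(createword u _) IHu.
apply/ffunP => I; rewrite !ffunE rcons_uniq map_rcons inversions_rcons.
have jE : uniq u -> t \notin u ->
    crossing q t (t |: [set i in u]) = (- q) ^+ count (ltn t) (map val u).
  move=> uu tu; rewrite crossingU1 ?inE // ltnn mul1r /crossing.
  rewrite (eq_bigl (mem u)) => [|i]; last by rewrite inE.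
  by rewrite -big_uniq // -big_mkcond /= big_const_seq iter_mulr mulr1
    count_map.
rewrite set_rcons.
have [uu|] := boolP (uniq u); last by rewrite andbF /= scaler0; case: ifP.
rewrite andbT /=; have [tu|tu] /= := boolP (t \in u).
  case: ifP => // tI; case: eqP => [E|]; last by rewrite scaler0.
  by have := setD11 t I; rewrite E inE tu.
have [->|nI] := eqVneq I (t |: [set i in u]).
  by rewrite setU11 setU1K ?inE // eqxx scalerA jE // -exprD addnC.
case: ifP => // tI; case: eqP => [E|]; last by rewrite scaler0.
by rewrite -E setD1K ?eqxx in nI.
Qed.

Lemma inversions_perm (s : 'S_m) :
  inversions (map val (mktuple s)) = perm_length s.
Proof.
rewrite /inversions size_map size_tuple.
transitivity (\sum_(b < m) \sum_(a < m) ((a < b) && (s b < s a))%N)%N.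
  apply: eq_bigr => b _; apply: eq_bigr => a _.
  have E (c : 'I_m) : nth 0%N (map val (mktuple s)) c = s c.
    by rewrite (nth_map c) ?size_tuple // -tnth_nth tnth_mktuple.
  by rewrite !E.
rewrite exchange_big pair_big /= /perm_length -sum1_card [RHS]big_mkcond.
by apply: eq_bigr => p _; rewrite inE; case: (_ && _).
Qed.

(** In the product of m columns, the words of rows without repetition are the
    permutations. *)
Lemma minor_leibniz (f : 'I_m -> 'I_n) (K : {set 'I_n}) :
  enum K = [seq f a | a <- enum 'I_m] ->
  minor q x K =
  \sum_(s : 'S_m) (- q) ^+ perm_length s *: \prod_(a < m) x (s a) (f a).
Proof.
move=> eK; have sK : size (enum K) = m by rewrite eK size_map size_enum_ord.
rewrite /minor (colprod_expand _ sK) sum_ffunE.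
transitivity (\sum_(u : m.-tuple 'I_m | uniq u)
    (- q) ^+ inversions (map val u) *: \prod_(p <- zip u (enum K)) x p.1 p.2).
  rewrite [RHS]big_mkcond; apply: eq_bigr => u _.
  rewrite ffunE createword_vac ffunE.
  have [uu|] := boolP (uniq u); last by rewrite mul0r.
  suff -> : [set: 'I_m] == [set i in u] by rewrite -scalerAl mul1r.
  by rewrite eq_sym eqEcard subsetT cardsT card_ord cardsE (card_uniqP uu)
    size_tuple /=.
(* Words with repetitions are sent to the identity, the default of insubd. *)
pose perm_of (u : m.-tuple 'I_m) : 'S_m :=
  @insubd _ _ 'S_m 1%g [ffun a => tnth u a].
rewrite (reindex_onto (fun s : 'S_m => mktuple s) perm_of) /=; last first.
  move=> u uu; apply: eq_from_tnth => a; rewrite tnth_mktuple.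
  rewrite -pvalE /perm_of insubdK ?ffunE //.
  by apply/injectiveP => b c; rewrite !ffunE; apply/tuple_uniqP.
apply: eq_big => [s|s _].
  rewrite map_inj_uniq ?enum_uniq; last exact: perm_inj.
  apply/eqP; rewrite /perm_of (_ : finfun _ = val s) ?valKd //.
  by apply/ffunP => a; rewrite ffunE tnth_mktuple -pvalE.
by rewrite inversions_perm eK /= zip_map big_map enumT.
Qed.
End Leibniz.

(** * The standard order *)

Section StandardOrder.
Variables (m n : nat).
Implicit Types (I J : Pi m n).

Lemma le_st_trans I J K : le_st I J -> le_st J K -> le_st I K.
Proof.
by move=> /forallP IJ /forallP JK; apply/forallP => s; apply: leq_trans (JK s).
Qed.

Lemma le_st_refl I : le_st I I.
Proof. exact/forallP. Qed.

Lemma Pi_elt_nth I s x0 : Pi_elt I s = nth x0 (enum (val I)) s.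
Proof. by rewrite /Pi_elt (enum_val_nth x0). Qed.

Lemma size_enum_Pi I : size (enum (val I)) = m.
Proof. by rewrite -cardE (eqP (valP I)). Qed.

Lemma enum_Pi I : enum (val I) = [seq Pi_elt I a | a <- enum 'I_m].
Proof.
have [x0|n0] := pickP (fun _ : 'I_n => true); last first.
  have e0 : enum (val I) = [::] by case: (enum _) => // y; have := n0 y.
  by rewrite e0; apply/esym/size0nil;
    rewrite size_map size_enum_ord -(size_enum_Pi I) e0.
move=> _; apply: (@eq_from_nth _ x0) => [|i].
  by rewrite size_map size_enum_ord size_enum_Pi.
rewrite size_enum_Pi => im; rewrite (nth_map (Ordinal im)) ?size_enum_ord //.
by rewrite (Pi_elt_nth _ _ x0) nth_enum_ord.
Qed.

Lemma le_st_anti I J : le_st I J -> le_st J I -> I = J.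
Proof.
move=> /forallP IJ /forallP JI; apply: val_inj.
rewrite -[val I]set_enum -[val J]set_enum !enum_Pi; apply/setP => i;
  rewrite !inE.
congr (_ \in _); apply: eq_map => s; apply: val_inj; apply/eqP.
by rewrite eqn_leq IJ JI.
Qed.

(** Comparing an entry of an increasing sequence with b amounts to counting the
    entries up to b.  Through this le_st becomes a comparison of counts, in which
    the replacement of one element is easy to follow. *)
Lemma nth_increasing_leq (w : seq nat) s b : pairwise ltn w -> (s < size w)%N ->
  (nth 0 w s <= b)%N = (s < count (leq^~ b) w)%N.
Proof.
elim: w s => // y w IHw s /= /andP[/allP yw iw].
have count0 : (b < y)%N -> count (leq^~ b) w = 0%N.
  move=> lby; apply/eqP; rewrite -leqn0 leqNgt -has_count.
  by apply/hasPn => t /yw /= lyt; rewrite -ltnNge (ltn_trans lby).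
case: s => [|s]; first by case: (leqP y b) => [|/count0 ->] //.
rewrite ltnS => sw; rewrite IHw //.
by case: (leqP y b) => [|/count0 ->] //.
Qed.

Lemma le_st_replace I J (a b : 'I_n) : a \in val I -> b \notin val I ->
  (b < a)%N -> val J = b |: (val I :\ a) -> le_st J I.
Proof.
move=> aI bI lba eJ; apply/forallP => s.
have count_enum (K : {set 'I_n}) c :
    count (leq^~ c) (map val (enum K)) = (\sum_(i in K) (i <= c))%N.
  by rewrite count_map -sum1_count [LHS]big_mkcond big_enum.
have le_elt (K : Pi m n) c :
    (Pi_elt K s <= c)%N = (s < \sum_(i in val K) (i <= c))%N.
  rewrite (Pi_elt_nth _ _ a) -(nth_map _ 0%N) ?size_enum_Pi //
    nth_increasing_leq.
  - by rewrite count_enum.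
  - by rewrite pairwise_map; apply: enum_increasing.
  - by rewrite size_map size_enum_Pi.
rewrite le_elt.
apply: leq_trans (_ : \sum_(i in val I) (i <= Pi_elt I s) <= _)%N.
  by rewrite -le_elt.
rewrite eJ (big_setD1 a aI) big_setU1 /=; last by rewrite !inE negb_and bI orbT.
rewrite leq_add2r; case: (leqP a) => // aE.
by rewrite (leq_trans (ltnW lba)).
Qed.
End StandardOrder.

(** * Normal elements modulo a prime ideal *)

Section Ideals.
Variables (k : fieldType) (A : algType k).
Implicit Types (P : set A) (a g r : A).

Lemma idealZ P c a : ideal P -> P a -> P (c *: a).
Proof. by move=> iP Pa; rewrite -mulr_algl; apply: idealMl. Qed.

Lemma ideal_subspace P : ideal P -> subspace (k := k) P.
Proof.
move=> iP; split=> [|c u v Pu Pv]; first exact: ideal0 iP.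
by apply: (idealD iP) => //; apply: (idealZ _ iP).
Qed.

(** Normality gives g A a inside P, and hence the product of the two-sided ideals
    generated by g and a lies in P. *)
Lemma prime_normal P g a : prime_ideal P ->
  (forall r, exists r', P (g * r - r' * g)) -> P (g * a) -> P g \/ P a.
Proof.
move=> [iP _ primeP] norm Pga.
have Pgra r : P (g * r * a).
  have [r' Pr] := norm r; rewrite -[g * r](subrK (r' * g)) mulrDl.
  by apply: (idealD iP); [apply: Defs.idealMr|rewrite -mulrA; apply: idealMl].
(* Largest ideals that annihilate a, respectively I, modulo P: they contain g
   and a by the previous step. *)
pose I x := forall r, P (x * r * a).
pose J y := forall x r, I x -> P (x * r * y).
have iI : ideal I.
  split=> [r|x y Ix Iy r|b x Ix r|b x Ix r].
  - by rewrite !mul0r; apply: ideal0 iP.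
  - by rewrite !mulrDl; apply: idealD.
  - by rewrite -!mulrA; apply: idealMl => //; rewrite mulrA.
  - by rewrite -(mulrA x).
have iJ : ideal J.
  split=> [x r _|x y Jx Jy z r Iz|b y Jy x r Ix|b y Jy x r Ix].
  - by rewrite mulr0; apply: ideal0 iP.
  - by rewrite mulrDr; apply: (idealD iP); [apply: Jx|apply: Jy].
  - by rewrite mulrA -(mulrA x); apply: Jy.
  - by rewrite mulrA; apply: Defs.idealMr => //; apply: Jy.
have [_ [x Ix [y Jy <-]]|IP|JP] := primeP I J iI iJ.
- by rewrite -[x]mulr1; apply: Jy.
- by left; apply: IP.
- by right; apply: JP => x r Ix; apply: Ix.
Qed.
End Ideals.

(** * Prime ideals of the quantum grassmannian *)

Section Grassmannian.
Variables (k : fieldType) (q : k) (m n : nat).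
Hypothesis hq : q != 0.
Local Notation O := (qgrass q m n).
Local Notation M := (@qgrass_minor k q m n).
Implicit Types (C D : Pi m n) (P : set O).

Lemma qmx_quantum_matrix : quantum_matrix q (@qmx_x k q m n).
Proof.
pose pi : qmx_free k m n -> qmx q m n := quot_pi (@qmx_ideal k q m n).
have rel0 u : qmx_rel q u -> pi u = 0.
  by move=> ru; apply/quot_pi_eq0 => I _; apply.
have piM u v : pi (u * v) = pi u * pi v by apply: rmorphM.
have piB u v : pi (u - v) = pi u - pi v by apply: raddfB.
have piZ c u : pi (c *: u) = c *: pi u by apply: linearZ.
split=> [i j l jl|i t j it|i t j l ti jl|i t j l it jl];
  apply/eqP; rewrite -subr_eq0 ?opprD ?addrA.
- by have := rel0 _ (QmxRow q i jl); rewrite piB piZ !piM => ->.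
- by have := rel0 _ (QmxCol q j it); rewrite piB piZ !piM => ->.
- by have := rel0 _ (QmxComm q ti jl); rewrite piB !piM => ->.
- by have := rel0 _ (QmxCross q it jl); rewrite !piB piZ !piM => ->.
Qed.

Lemma qgrass_minorE C : val (M C) = minor q (@qmx_x k q m n) (val C).
Proof. by rewrite (minor_leibniz _ _ (enum_Pi C)). Qed.

Lemma val_qgrassM (u v : O) : val (u * v) = val u * val v.
Proof. exact: rmorphM. Qed.

Lemma val_qgrassP c (u v : O) : val (c *: u + v) = c *: val u + val v.
Proof. exact: linearP. Qed.

(** Induction on the generation of the subalgebra by the minors. *)
Lemma qgrass_ind (S : O -> Prop) :
  S 1 -> (forall c u v, S u -> S v -> S (c *: u + v)) ->
  (forall u v, S u -> S v -> S (u * v)) -> (forall C, S (M C)) ->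
  forall u, S u.
Proof.
move=> S1 SP SM SC u.
pose B : {pred qmx q m n} := fun v => `[< exists2 w : O, S w & val w = v >].
have BP v : reflect (exists2 w : O, S w & val w = v) (v \in B).
  exact: asboolP.
have clB : GRing.subalg_closed B.
  split.
  - by apply/BP; exists 1.
  - move=> c _ _ /BP[v Sv <-] /BP[w Sw <-].
    by apply/BP; exists (c *: v + w); [apply: SP|rewrite val_qgrassP].
  - move=> _ _ /BP[v Sv <-] /BP[w Sw <-].
    by apply/BP; exists (v * w); [apply: SM|rewrite val_qgrassM].
have genB s : range (@qminor k q m n) s -> s \in B.
  by case=> C _ <-; apply/BP; exists (M C).
by have /subalg_genP/(_ B clB genB)/BP[w Sw /val_inj <-] := valP u.
Qed.

(** The ideal P inside the algebra of quantum matrices, where the identities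
    between minors are proved. *)
Definition image_of P (v : qmx q m n) : Prop := exists2 u : O, P u & val u = v.

Lemma image_ofP P u : image_of P (val u) -> P u.
Proof. by case=> w Pw /val_inj <-. Qed.

Lemma image_of_subspace P : ideal P -> subspace (image_of P).
Proof.
move=> iP; split; first by exists 0; rewrite ?linear0 //; apply: ideal0 iP.
move=> c _ _ [u Pu <-] [v Pv <-]; exists (c *: u + v);
  last by rewrite val_qgrassP.
by have [_] := ideal_subspace iP; apply.
Qed.

Lemma ex_Pi (K : {set 'I_n}) : #|K| == m -> exists C : Pi m n, val C = K.
Proof. by move=> cK; exists (exist (fun I : {set 'I_n} => #|I| == m) K cK). Qed.

Lemma qgrass_exchange P C D a : ideal P -> a \in val D -> a \notin val C ->
  (forall C' D' b, b \in val C -> b \notin val D ->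
     val C' = a |: (val C :\ b) -> val D' = b |: (val D :\ a) ->
     P (M C' * M D')) ->
  P (M C * M D).
Proof.
move=> iP aD aC PCD; apply: image_ofP; rewrite val_qgrassM !qgrass_minorE.
apply: (minor_exchange hq qmx_quantum_matrix (image_of_subspace iP) aD aC).
move=> b bC bD.
have card_replace (K : {set 'I_n}) c d : #|K| == m -> c \in K -> d \notin K ->
    #|d |: (K :\ c)| == m.
  by move=> /eqP<- cK dK; rewrite cardsU1 !inE (negbTE dK) andbF (cardsD1 c K)
    cK.
have cardC := card_replace _ _ _ (valP C) bC aC.
have cardD := card_replace _ _ _ (valP D) aD bD.
have [[C' eC'] [D' eD']] := (ex_Pi cardC, ex_Pi cardD).
exists (M C' * M D'); first exact: (PCD C' D' b).
by rewrite val_qgrassM !qgrass_minorE eC' eD'.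
Qed.

Lemma qgrass_comm P C D : ideal P ->
  (forall C', (weight (val C') < weight (val C))%N -> P (M C')) ->
  exists2 c, c != 0 & P (M D * M C - c *: (M C * M D)).
Proof.
move=> iP PC.
have [c c0 cE] := minor_comm hq qmx_quantum_matrix (val C) (val D).
exists c => //; apply: image_ofP.
rewrite addrC -scaleNr val_qgrassP !val_qgrassM !qgrass_minorE scaleNr addrC.
apply: cE => [|K L]; first exact: image_of_subspace.
rewrite (eqP (valP C)) (eqP (valP D)) => /eqP cK /eqP cL ltK.
have [[C' eC'] [D' eD']] := (ex_Pi cK, ex_Pi cL).
exists (M C' * M D'); last by rewrite val_qgrassM !qgrass_minorE eC' eD'.
by apply: Defs.idealMr => //; apply: PC; rewrite eC'.
Qed.

(** The elements r for which such an r' exists form a subalgebra, which contains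
    the minors by qgrass_comm. *)
Lemma qgrass_normal P C : ideal P ->
  (forall C', (weight (val C') < weight (val C))%N -> P (M C')) ->
  forall r, exists r', P (M C * r - r' * M C).
Proof.
move=> iP PC; apply: qgrass_ind.
- by exists 1; rewrite mulr1 mul1r subrr; apply: ideal0 iP.
- move=> c u v [u' Pu] [v' Pv]; exists (c *: u' + v').
  rewrite mulrDr mulrDl -scalerAr -scalerAl opprD addrACA -scalerBr.
  by apply: (idealD iP) => //; apply: (idealZ _ iP).
- move=> u v [u' Pu] [v' Pv]; exists (u' * v').
  rewrite -(subrKA (u' * M C * v)) !mulrA -mulrBl -!(mulrA u') -mulrBr.
  by apply: (idealD iP); [apply: Defs.idealMr|apply: idealMl].
(* From P containing D C - c C D, with c invertible. *)
- move=> D; have [c c0 Pc] := qgrass_comm D iP PC; exists (c^-1 *: M D).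
  have := idealZ (- c^-1) iP Pc.
  by rewrite scalerBr !scaleNr scalerA mulVf // scale1r opprK addrC -scalerAl.
Qed.

(** Each element is a scalar modulo the irrelevant ideal, and a proper ideal
    contains no nonzero scalar. *)
Lemma prime_irrelevant P : prime_ideal P -> (forall C, P (M C)) ->
  P = irrelevant_ideal q m n.
Proof.
move=> [iP nP _] PM; have iI : ideal (irrelevant_ideal q m n) :=
  ideal_gen_ideal _.
have MI C : irrelevant_ideal q m n (M C) by move=> I _ sI; apply: sI; exists C.
have IP v : irrelevant_ideal q m n v -> P v.
  by move=> Iv; apply: (Iv P) => // _ [C _ <-].
apply/seteqP; split=> // u Pu.
have [c Ic] : exists c, irrelevant_ideal q m n (u - c *: 1).
  move: u {Pu}; apply: qgrass_ind.
  - by exists 1; rewrite scale1r subrr; apply: ideal0 iI.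
  - move=> a u v [c Ic] [d Id]; exists (a * c + d).
    rewrite scalerDl opprD addrACA -scalerA -scalerBr.
    by apply: (idealD iI) => //; apply: (idealZ _ iI).
  - move=> u v [c Ic] [d Id]; exists (c * d).
    have -> : u * v - (c * d) *: 1 = (u - c *: 1) * v + c *: (v - d *: 1).
      by rewrite mulrBl mulr_algl scalerBr scalerA addrA subrK.
    by apply: (idealD iI); [apply: (Defs.idealMr iI)|apply: (idealZ _ iI)].
  - by move=> C; exists 0; rewrite scale0r subr0.
have [c0|c0] := eqVneq c 0; first by move: Ic; rewrite c0 scale0r subr0.
case: nP; apply/seteqP; split=> // v _; rewrite -[v]mulr1; apply: idealMl => //.
have Pc1 : P (c *: 1).
  by rewrite -[_ *: _](subKr u); apply: (idealD iP) => //;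
    apply: idealN => //; apply: IP.
by rewrite -[1](scalerK c0); apply: idealZ.
Qed.

(** Induction on the weight of D, by exchanging an element a of D that is not in C
    with the elements b of C. *)
Lemma prime_not_ge P C : prime_ideal P -> ~ P (M C) ->
  (forall C', (weight (val C') < weight (val C))%N -> P (M C')) ->
  forall D, ~~ le_st C D -> P (M D).
Proof.
move=> hP nPC PC D; have [iP _ _] := hP.
have [N] := ubnP (weight (val D)); elim: N D => // N IHN D;
  rewrite ltnS => ltN nCD.
suff PCD : P (M C * M D).
  by case: (prime_normal hP (qgrass_normal iP PC) PCD) => [/nPC|].
have /subsetPn[a aD aC] : ~~ (val D \subset val C).
  apply: contra nCD => sDC; suff -> : C = D by apply: le_st_refl.
  by apply/val_inj/esym/eqP;
    rewrite eqEcard sDC (eqP (valP C)) (eqP (valP D)) leqnn.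
apply: (qgrass_exchange iP aD aC) => C' D' b bC bD eC' eD'.
(* For b > a the first factor has weight less than C, and for b < a the
   second one is below D, so that it is not above C either. *)
have [lab|lba|/val_inj eab] := ltngtP a b; last by rewrite eab bC in aC.
  by apply: Defs.idealMr => //; apply: PC; rewrite eC' weight_replace.
apply: idealMl => //; apply: IHN.
  by apply: leq_trans ltN; rewrite eD' weight_replace.
by apply: contra nCD => /le_st_trans; apply; apply: le_st_replace eD'.
Qed.
End Grassmannian.

Theorem theorem4p1 (k : fieldType) (q : k) (m n : nat)
    (hq : q != 0) (hm : (0 < m)%N) (hmn : (m <= n)%N)
    (P : set (qgrass q m n)) (hP : prime_ideal P)
    (hirr : P <> irrelevant_ideal q m n) :
  exists! gamma : Pi m n,
    ~ P (qgrass_minor q gamma) /\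
    forall pi : Pi m n, ~~ le_st gamma pi -> P (qgrass_minor q pi).
Proof.
have [C0 nPC0] : exists C, ~ P (qgrass_minor q C).
  by apply: contrapT => nP; apply: hirr; apply: prime_irrelevant => // C;
    apply: contrapT => nPC; apply: nP; exists C.
have [C /asboolPn nPC Cmin] := @arg_minnP _ C0
  (fun C => ~~ `[< P (qgrass_minor q C) >]) (fun C => weight (val C))
  (introN (asboolP _) nPC0).
have lowC C' : (weight (val C') < weight (val C))%N -> P (qgrass_minor q C').
  by move=> ltC; apply: contrapT => /asboolPn /Cmin; rewrite leqNgt ltC.
have upC := prime_not_ge hq hP nPC lowC.
exists C; split=> // D [nPD upD]; apply: le_st_anti.
  by apply: contrapT => /negP /upC.
by apply: contrapT => /negP /upD.
Qed.
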